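(* Let $T$ be a Schreier transversal for a right ideal $I\leq\mathcal{A}=K[F]$. There exists an exposure order $\prec_T^+$ on $F$ such that $B_{I,\prec_T^+}=B_T^+$, where $B_{I,\prec_T^+}$ is the exposure basis of $I$ with respect to $\prec_T^+$ and $B_T^+$ is the Lewin basis induced by $T$.
   Context: $K$ is a field, $F$ is a free group with finite basis $S$ (elements are reduced words in $S\cup S^{-1}$), and $\mathcal{A}=K[F]$. The support $\mathrm{supp}(f)$ of $f\in\mathcal{A}$ is the set of words with nonzero coefficient in $f$; $f$ is supported on $T\subseteq F$ if $\mathrm{supp}(f)\subseteq T$. $\mathrm{Sp}_K(T)$ is the $K$-span of $T$. A Schreier transversal for $I$ is a prefix-closed subset $T\subseteq F$ such that $\mathrm{Sp}_K(T)\cap I=\{0\}$ and every $I$-coset in $\mathcal{A}$ intersects $\mathrm{Sp}_K(T)$. A prefix-neighbor of a prefix-closed set $T$ is a word not in $T$ all of whose proper prefixes lie in $T$ (so the only prefix-neighbor of $\emptyset$ is the empty word). Lewin basis: for a Schreier transversal $T$ for $I$, let $\phi_{I,T}:\mathcal{A}\to\mathrm{Sp}_K(T)$ send $f$ to the unique element of $f+I$ supported on $T$, and let $\partial_+T$ be the set of prefix-neighbors of $T$ which are either the empty word or whose last letter lies in $S$ (rather than $S^{-1}$). Then $B_T^+=\{v-\phi_{I,T}(v):v\in\partial_+T\}$. (By a theorem of Lewin, this is a basis of $I$ as a free right $\mathcal{A}$-module.) An exposure order on $F$ is a well-order $\prec$ on $F$ such that $u\preceq v$ whenever $u$ is a prefix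 of $v$. For distinct subsets $A,B\subseteq F$: $A\prec_{\min}B$ if $\min(A\triangle B)\in A$ (a total order on subsets). For distinct finite subsets: $A\prec_{\max}B$ if $\max(A\triangle B)\in B$ (a well-order on finite subsets). For $0\ne f\in\mathcal{A}$, the head term of $f$ is the $\prec$-maximal word in $\mathrm{supp}(f)$; $f$ is monic if its head term has coefficient $1$. The set of Schreier transversals for $I$ has a $\prec_{\min}$-minimum, denoted $T_I=T_{I,\prec}$. Exposure basis of $I$ with respect to $\prec$: define $f_\alpha\in I$ by transfinite recursion. Given $f_\beta$ for all $\beta<\alpha$, let $I_\alpha$ be the right ideal generated by $\{f_\beta:\beta<\alpha\}$. If $I_\alpha=I$, stop and set $\omega_I:=\alpha$. Otherwise let $f_\alpha$ be the unique monic element of $I$ whose support is $\prec_{\max}$-minimal among the monic elements of $I$ supported on $T_{I_\alpha}$ (it exists and is unique, and the process always stops). Then $B_{I,\prec}=\{f_\alpha:\alpha<\omega_I\}$. *)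

(* Defs.v *)
From HB Require Import structures.
From mathcomp Require Import all_boot ssralg finmap.
From mathcomp Require Import boolp classical_sets wochoice.
From mathcomp.multinomials Require Import monalg.

Set Implicit Arguments.
Unset Strict Implicit.
Unset Printing Implicit Defensive.

Import GRing.Theory.
Local Open Scope fset_scope.
Local Open Scope classical_set_scope.
Local Open Scope ring_scope.

(* The letter [(s, false)] stands for s and [(s, true)] for s^-1. *)
Definition letter (S : finType) : Type := (S * bool)%type.

Section FreeGroup.
Variable S : finType.
Implicit Types (a b : letter S) (u v w : seq (letter S)).

Definition letter_inv a : letter S := (a.1, ~~ a.2).

Definition reduced w : bool := sorted (fun a b => b != letter_inv a) w.

Definition push a w : seq (letter S) :=
  if w is b :: w' then if b == letter_inv a then w' else a :: w else [:: a].

Definition reduce w : seq (letter S) := foldr push [::] w.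

Lemma letter_invK : involutive letter_inv.
Proof. by case=> s b; rewrite /letter_inv /= negbK. Qed.

Lemma push_reduced a w : reduced w -> reduced (push a w).
Proof.
case: w => [//|b w] /= pw; case: eqP => [_|/eqP nba]; first exact: path_sorted pw.
by rewrite /= nba.
Qed.

Lemma reduce_reduced w : reduced (reduce w).
Proof. by elim: w => //= a w; apply: push_reduced. Qed.

Lemma reduce_id w : reduced w -> reduce w = w.
Proof.
elim: w => //= a w IHw pw; rewrite IHw; last exact: path_sorted pw.
by case: w pw {IHw} => //= b w /andP[/negPf-> _].
Qed.

Lemma pushK a w : reduced w -> push a (push (letter_inv a) w) = w.
Proof.
case: w => [|b w] /=; first by rewrite eqxx.
rewrite letter_invK; case: eqP => [->|_ _ /=]; last by rewrite eqxx.
by case: w => //= c w /andP[/negPf->].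
Qed.

Lemma reduce_cat u v : reduce (u ++ v) = foldr push (reduce v) u.
Proof. by rewrite /reduce foldr_cat. Qed.

Lemma foldr_push_reduce w u :
  reduced w -> foldr push w (reduce u) = foldr push w u.
Proof.
move=> rw; have rf x : reduced (foldr push w x).
  by elim: x => //= a x; apply: push_reduced.
elim: u => //= a u <-; case: (reduce u) => //= b x.
by case: eqP => [->|//]; rewrite pushK.
Qed.

Lemma reduce_catl u v : reduce (reduce u ++ v) = reduce (u ++ v).
Proof. by rewrite !reduce_cat foldr_push_reduce ?reduce_reduced. Qed.

Lemma reduce_catr u v : reduce (u ++ reduce v) = reduce (u ++ v).
Proof. by rewrite !reduce_cat (reduce_id (reduce_reduced v)). Qed.

Definition word_inv w : seq (letter S) := rev (map letter_inv w).

Lemma word_inv_reduced w : reduced w -> reduced (word_inv w).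
Proof.
rewrite /reduced /word_inv rev_sorted sorted_map; apply: sub_sorted => a b /=.
by apply: contra => /eqP->; rewrite letter_invK.
Qed.

Lemma word_invK : involutive word_inv.
Proof.
by move=> w; rewrite /word_inv map_rev revK -map_comp (eq_map letter_invK) map_id.
Qed.

Lemma reduce_inv w : reduce (word_inv w ++ w) = [::].
Proof.
elim: w => //= a w IHw.
rewrite /word_inv /= rev_cons cat_rcons -reduce_catr /=.
have := pushK (letter_inv a) (reduce_reduced w).
by rewrite letter_invK => ->; rewrite reduce_catr.
Qed.

Record free_group : predArgType :=
  FreeGroup { word :> seq (letter S); wordP : reduced word }.

HB.instance Definition _ := [isSub for word].
HB.instance Definition _ := [Choice of free_group by <:].

Implicit Types x y z : free_group.

Definition fg_one : free_group := @FreeGroup [::] isT.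
Definition fg_mul x y : free_group :=
  FreeGroup (reduce_reduced (word x ++ word y)).
Definition fg_inv x : free_group := FreeGroup (word_inv_reduced (wordP x)).

Lemma fg_mulA : associative fg_mul.
Proof. by move=> x y z; apply/val_inj; rewrite /= reduce_catl reduce_catr catA. Qed.

Lemma fg_mul1 : left_id fg_one fg_mul.
Proof. by move=> x; apply/val_inj/reduce_id/wordP. Qed.

Lemma fg_mulr1 : right_id fg_one fg_mul.
Proof. by move=> x; apply/val_inj; rewrite /= cats0; apply/reduce_id/wordP. Qed.

Lemma fg_mulVg : left_inverse fg_one fg_inv fg_mul.
Proof. by move=> x; apply/val_inj/reduce_inv. Qed.

Lemma fg_mulgV : right_inverse fg_one fg_inv fg_mul.
Proof. by move=> x; apply/val_inj; rewrite /= -{1}[word x]word_invK reduce_inv. Qed.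

HB.instance Definition _ := isGroup.Build free_group
  fg_mulA fg_mul1 fg_mulr1 fg_mulVg fg_mulgV.

End FreeGroup.

(* [{malg K[G]}] only carries a product when G is a monomial type, which
   excludes nontrivial groups; hence the alias with its own ring structure. *)
Definition group_algebra (K : nzRingType) (G : groupType) : Type := {malg K[G]}.

Section GroupAlgebra.
Variables (K : nzRingType) (G : groupType).
Local Notation A := (group_algebra K G).

HB.instance Definition _ := GRing.Lmodule.on A.

Implicit Types (f g h : A) (x y : G).

Definition ga_one : A := << 1%g >>.

Definition ga_mul f g : A :=
  \sum_(x <- msupp f) \sum_(y <- msupp g) << f@_x * g@_y *g (x * y)%g >>.

Lemma ga_mulw (d1 d2 : {fset G}) f g :
  (msupp f `<=` d1)%fset -> (msupp g `<=` d2)%fset ->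
  ga_mul f g = \sum_(x <- d1) \sum_(y <- d2) << f@_x * g@_y *g (x * y)%g >>.
Proof.
move=> le1 le2; rewrite /ga_mul (big_fset_incl _ le1) /=.
  apply/eq_bigr=> x _; apply/big_fset_incl => // y _ /mcoeff_outdom ->.
  by rewrite mulr0 monalgU0.
move=> x _ /mcoeff_outdom fx.
by rewrite big1 => // y _; rewrite fx mul0r monalgU0.
Qed.

Lemma ga_mul0 : left_zero 0 ga_mul.
Proof. by move=> f; rewrite /ga_mul msupp0 big_seq_fset0. Qed.

Lemma ga_mulr0 : right_zero 0 ga_mul.
Proof.
by move=> f; rewrite /ga_mul big1 // => x _; rewrite msupp0 big_seq_fset0.
Qed.

Lemma ga_mulDl : left_distributive ga_mul +%R.
Proof.
move=> f g h; rewrite (ga_mulw (msuppD_le f g) (fsubset_refl _)).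
rewrite (ga_mulw (fsubsetUl _ (msupp g)) (fsubset_refl _)).
rewrite (ga_mulw (fsubsetUr (msupp f) _) (fsubset_refl _)) -big_split /=.
apply/eq_bigr=> x _; rewrite -big_split /=; apply/eq_bigr=> y _.
by rewrite mcoeffD mulrDl monalgUD.
Qed.

Lemma ga_mulDr : right_distributive ga_mul +%R.
Proof.
move=> h f g; rewrite (ga_mulw (fsubset_refl _) (msuppD_le f g)).
rewrite (ga_mulw (fsubset_refl _) (fsubsetUl _ (msupp g))).
rewrite (ga_mulw (fsubset_refl _) (fsubsetUr (msupp f) _)) -big_split /=.
apply/eq_bigr=> x _; rewrite -big_split /=; apply/eq_bigr=> y _.
by rewrite mcoeffD mulrDr monalgUD.
Qed.

Lemma ga_mulUU c d x y :
  ga_mul << c *g x >> << d *g y >> = << c * d *g (x * y)%g >>.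
Proof. by rewrite (ga_mulw msuppU_le msuppU_le) !big_seq_fset1 !mcoeffUU. Qed.

Lemma ga_ind (P : A -> Prop) :
  P 0 -> (forall f g, P f -> P g -> P (f + g)) -> (forall c x, P << c *g x >>) ->
  forall f, P f.
Proof. by move=> P0 PD PU f; rewrite (monalgE f); apply: big_ind. Qed.

Lemma ga_mulA : associative ga_mul.
Proof.
move=> f g h; elim/ga_ind: f => [|f1 f2 IH1 IH2|c x].
- by rewrite !ga_mul0.
- by rewrite !ga_mulDl IH1 IH2.
elim/ga_ind: g => [|g1 g2 IH1 IH2|d y].
- by rewrite ga_mul0 ga_mulr0 ga_mul0.
- by rewrite ga_mulDl !ga_mulDr ga_mulDl IH1 IH2.
elim/ga_ind: h => [|h1 h2 IH1 IH2|e z].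
- by rewrite !ga_mulr0.
- by rewrite !ga_mulDr IH1 IH2.
by rewrite !ga_mulUU mulrA mulgA.
Qed.

Lemma ga_mul1 : left_id ga_one ga_mul.
Proof.
elim/ga_ind => [|f g IH1 IH2|c x]; first by rewrite ga_mulr0.
  by rewrite ga_mulDr IH1 IH2.
by rewrite ga_mulUU mul1r mul1g.
Qed.

Lemma ga_mulr1 : right_id ga_one ga_mul.
Proof.
elim/ga_ind => [|f g IH1 IH2|c x]; first by rewrite ga_mul0.
  by rewrite ga_mulDl IH1 IH2.
by rewrite ga_mulUU mulr1 mulg1.
Qed.

Lemma ga_one_neq0 : ga_one != 0.
Proof.
apply/eqP=> /(congr1 (mcoeff 1%g)) /eqP.
by rewrite mcoeffUU mcoeff0 oner_eq0.
Qed.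

HB.instance Definition _ := GRing.Zmodule_isNzRing.Build A
  ga_mulA ga_mul1 ga_mulr1 ga_mulDl ga_mulDr ga_one_neq0.

Lemma ga_scaleAl (c : K) f g : c *: (f * g) = (c *: f) * g.
Proof.
have scaleE h : c *: h = ga_mul << c *g 1%g >> h.
  elim/ga_ind: h => [|h1 h2 IH1 IH2|d x]; first by rewrite scaler0 ga_mulr0.
    by rewrite scalerDr IH1 IH2 ga_mulDr.
  rewrite ga_mulUU mul1g; apply/malgP => y.
  by rewrite mcoeffZ !mcoeffU mulrnAr.
by rewrite !scaleE; apply: ga_mulA.
Qed.

HB.instance Definition _ := GRing.Lmodule_isLalgebra.Build K A ga_scaleAl.

Definition right_ideal (I : set A) : Prop :=
  [/\ I 0, forall f g, I f -> I g -> I (f + g) & forall f a, I f -> I (f * a)].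

Definition right_ideal_generated (X : set A) : set A := smallest right_ideal X.

Definition supported_on (f : A) (T : set G) : Prop := [set` msupp f] `<=` T.

End GroupAlgebra.

Section Transversals.
Variables (K : fieldType) (S : finType).
Local Notation F := (free_group S).
Local Notation A := (group_algebra K (free_group S)).
Implicit Types (I J : set A) (T : set F) (f g : A) (u v : F).

Definition prefix_closed T : Prop :=
  forall u v, prefix (word u) (word v) -> T v -> T u.

Definition schreier_transversal I T : Prop :=
  [/\ prefix_closed T,
      forall f, supported_on f T -> I f -> f = 0
    & forall f, exists2 g, supported_on g T & I (f - g)].

Definition prefix_neighbor T : set F :=
  [set v | ~ T v /\ forall u, prefix (word u) (word v) -> u <> v -> T u].

Definition pos_prefix_neighbor T : set F :=
  [set v | prefix_neighbor T v /\
           (word v = [::] \/ exists w s, word v = rcons w (s, false))].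

Definition coset_repr I T f : A :=
  xget 0 [set g : A | I (g - f) /\ supported_on g T].

Definition lewin_basis I T : set A :=
  [set << v >> - coset_repr I T << v >> | v in pos_prefix_neighbor T].

End Transversals.

Section Exposure.
Variables (K : fieldType) (S : finType).
Local Notation F := (free_group S).
Local Notation A := (group_algebra K (free_group S)).

(* Orders are given by their reflexive relation. *)
Definition strict (W : Type) (le : rel W) (x y : W) : Prop := le x y /\ x <> y.

Definition exposure_order (le : rel F) : Prop :=
  well_order le /\ forall u v : F, prefix (word u) (word v) -> le u v.

Variable le : rel F.
Implicit Types (I J : set A) (T : set F) (f g : A) (X Y : set F).

Definition symdiff X Y : set F := (X `\` Y) `|` (Y `\` X).

Definition lt_min X Y : Prop :=
  exists m, X m /\ symdiff X Y m /\ forall x, symdiff X Y x -> le m x.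

Definition lt_max X Y : Prop :=
  exists m, Y m /\ symdiff X Y m /\ forall x, symdiff X Y x -> le x m.

Definition head_term f (u : F) : Prop :=
  u \in msupp f /\ forall v, v \in msupp f -> le v u.

Definition monic f : Prop := exists2 u, head_term f u & f@_u = 1.

Definition min_transversal I : set F :=
  xget set0 [set T | schreier_transversal I T /\
    forall T', schreier_transversal I T' -> T' <> T -> lt_min T T'].

Definition exposure_candidate I J : set A :=
  [set f | [/\ I f, monic f & supported_on f (min_transversal J)]].

Definition support_minimal (C : set A) : set A :=
  [set f | C f /\ forall g, C g ->
     msupp g <> msupp f -> lt_max [set` msupp f] [set` msupp g]].

(* The transfinite sequence f of the recursion, with the ordinal omega_I
   represented by a well-ordered type W of that order type; its range does not depend
   on the chosen W and f, see [exposure_basis_unique] below. *)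
Definition exposure_ideal (W : Type) (leW : rel W) (f : W -> A) (a : W) : set A :=
  right_ideal_generated [set f b | b in [set b | strict leW b a]].

Definition exposure_sequence I (W : Type) (leW : rel W) (f : W -> A) : Prop :=
  [/\ well_order leW,
      forall a, exposure_ideal leW f a <> I,
      forall a, unique (support_minimal
                  (exposure_candidate I (exposure_ideal leW f a))) (f a)
    & right_ideal_generated (range f) = I].

Definition is_exposure_basis I (B : set A) : Prop :=
  exists (W : Type) (leW : rel W) (f : W -> A),
    exposure_sequence I leW f /\ B = range f.

Lemma well_order_least (W : Type) (leW : rel W) (P : W -> Prop) :
  well_order leW -> (exists a, P a) -> exists2 a, P a & forall b, P b -> leW a b.
Proof.
move=> wo [a Pa]; have [|m [[/asboolP Pm minm] _]] := wo [pred x | `[<P x>]].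
  by exists a; apply/asboolP.
by exists m => // b Pb; apply: minm; apply/asboolP.
Qed.

Lemma well_order_anti (W : Type) (leW : rel W) a b :
  well_order leW -> leW a b -> leW b a -> a = b.
Proof.
move=> wo ab ba; pose P := [pred x | `[<x = a \/ x = b>]].
have in_P x : reflect (x = a \/ x = b) (x \in P) by apply: asboolP.
have refl x : leW x x.
  by have [|y -> /(_ x erefl)] := well_order_least (P := eq^~ x) wo; first by exists x.
have [|m [_ mu]] := wo P; first by exists a; apply/in_P; left.
have mina : minimum_of leW P a.
  by split=> [|x /in_P[->|->]] //; apply/in_P; left.
have minb : minimum_of leW P b.
  by split=> [|x /in_P[->|->]] //; apply/in_P; right.
by rewrite -(mu a mina) -(mu b minb).
Qed.

Lemma strict_or (W : Type) (leW : rel W) a b :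
  well_order leW -> [\/ strict leW a b, a = b | strict leW b a].
Proof.
move=> wo; have [eab|nab] := pselect (a = b); first by constructor 2.
have [|c] := well_order_least (P := fun x => x = a \/ x = b) wo; first by exists a; left.
case=> -> lec; first by constructor 1; split=> //; apply: lec; right.
by constructor 3; split; [apply: lec; left | move=> /esym].
Qed.

Lemma strict_trans (W : Type) (leW : rel W) a b c :
  well_order leW -> strict leW a b -> strict leW b c -> strict leW a c.
Proof.
move=> wo [ab nab] [bc nbc].
have [//|eac|[ca nca]] := strict_or a c wo.
  by case: nab; rewrite eac in ab *; exact: (well_order_anti wo).
have [|m] := well_order_least (P := fun x => [\/ x = a, x = b | x = c]) wo.
  by exists a; constructor 1.
case=> -> lem.
- by case: nca; apply: (well_order_anti wo) => //; apply: lem; constructor 3.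
- by case: nab; apply: (well_order_anti wo) => //; apply: lem; constructor 1.
- by case: nbc; apply: (well_order_anti wo) => //; apply: lem; constructor 2.
Qed.

Lemma strict_ind (W : Type) (leW : rel W) (P : W -> Prop) : well_order leW ->
  (forall a, (forall b, strict leW b a -> P b) -> P a) -> forall a, P a.
Proof.
move=> wo step a; apply: contrapT => nPa.
have [|m nPm minm] := well_order_least (P := fun x => ~ P x) wo; first by exists a.
apply: nPm; apply: step => b [bm nbm]; apply: contrapT => /minm mb.
by apply: nbm; apply: (well_order_anti wo).
Qed.

Lemma support_minimal_new I J f :
  support_minimal (exposure_candidate I J) f -> ~ J f.
Proof.
case=> -[_ [u [uf _] _] fT] _ Jf; move: fT; rewrite /min_transversal.
case: xgetP => [T _ [[_ sep _] _] fT|_ /(_ _ uf) []].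
by move: uf; rewrite (sep _ fT Jf) msupp0 in_fset0.
Qed.

Lemma exposure_sequence_inj I (W : Type) (leW : rel W) (f : W -> A) :
  exposure_sequence I leW f -> injective f.
Proof.
move=> [wo _ step _]; suff lt_neq a b : strict leW a b -> f a <> f b.
  move=> a b eab; have [/lt_neq //|//|/lt_neq ba] := strict_or a b wo.
  by case: ba.
move=> ab eab; have [/support_minimal_new + _] := step b; apply.
by apply: sub_gen_smallest; exists a.
Qed.

Lemma exposure_sequence_sub I (W W' : Type) (leW : rel W) (leW' : rel W')
    (f : W -> A) (f' : W' -> A) :
  exposure_sequence I leW f -> exposure_sequence I leW' f' ->
  range f `<=` range f'.
Proof.
move=> sf sf'; have inj := exposure_sequence_inj sf.
have inj' := exposure_sequence_inj sf'.
case: sf sf' => [wo nI step _] [wo' _ step' gen'].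
pose seg a := [set f b | b in [set b | strict leW b a]].
pose seg' a := [set f' b | b in [set b | strict leW' b a]].
suff match_ a : exists2 a', f a = f' a' & seg a = seg' a'.
  by move=> _ [a _ <-]; have [a' -> _] := match_ a; exists a'.
move: a; apply: (strict_ind wo) => a IH.
have [|a' na' mina'] := well_order_least (P := fun a' => ~ seg a (f' a')) wo'.
  apply: contrapT => noa'; apply: (nI a); rewrite -gen' /exposure_ideal.
  congr right_ideal_generated; apply/seteqP; split=> _ [b Pb <-].
    by have [b' -> _] := IH b Pb; exists b'.
  by apply: contrapT => nb; apply: noa'; exists b.
have segE : seg a = seg' a'.
  apply/seteqP; split=> [_ [b ba <-]|_ [b' [b'a' nb'a'] <-]]; last first.
    apply: contrapT => /mina' a'b'; apply: nb'a'.
    exact: (well_order_anti wo').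
  have [b' eb segb] := IH b ba; rewrite eb; exists b' => //.
  have [//|eb'|a'b'] := strict_or b' a' wo'.
    by case: na'; rewrite -eb' -eb; exists b.
  have : seg' b' (f' a') by exists a'.
  rewrite -segb => -[c cb ec]; case: na'; rewrite -ec; exists c => //.
  exact: strict_trans cb ba.
exists a' => //; have [_ uniq_f] := step' a'; have [+ _] := step a.
by rewrite /exposure_ideal -/(seg a) -/(seg' a') segE => /uniq_f->.
Qed.

Lemma exposure_basis_unique I (B B' : set A) :
  is_exposure_basis I B -> is_exposure_basis I B' -> B = B'.
Proof.
move=> [W [leW [f [sf ->]]]] [W' [leW' [f' [sf' ->]]]].
by apply/seteqP; split; [exact: exposure_sequence_sub sf sf'
                        | exact: exposure_sequence_sub sf' sf].
Qed.

End Exposure.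

(* Main.v *)
(* Write b_v = v - phi(v) for v in d_+ T, and let the order list first T, then
   d_+ T, then all other words, each of the three layers by increasing length.
   If J_v is the right ideal generated by the b_w with w < v in d_+ T, then the
   minimal transversal Y of J_v contains T and all w >= v in d_+ T, but no w < v
   in d_+ T. An element of I supported on Y therefore has its head term at v or
   later, because Sp(T) meets I trivially, and b_v is the only monic one with
   head term v. So b_v is exactly what the exposure process picks after J_v.

   Two facts of Lewin's theorem enter. The b_v generate I: Sp(T) + (b_v) is
   stable under right multiplication by letters. And they are independent: for
   each v a Fox derivative, which is invariant on I under right multiplication by
   words, takes the value 1 at b_v and 0 at the other b_w. *)
Require Import Defs.
From mathcomp Require Import all_boot ssralg classical_sets.
From mathcomp Require Import finmap boolp wochoice.
From mathcomp.multinomials Require Import monalg.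

Set Implicit Arguments.
Unset Strict Implicit.
Unset Printing Implicit Defensive.

Import GRing.Theory.
Local Open Scope classical_set_scope.
Local Open Scope ring_scope.

(** * Well-orders, their lexicographic refinements and restrictions *)

Section WellOrder.
Variable W : Type.
Implicit Types (R : rel W) (a b : W).

Lemma well_order_refl R : well_order R -> reflexive R.
Proof.
move=> wo x.
by have [|y -> /(_ x erefl)] := well_order_least (P := eq^~ x) wo; first by exists x.
Qed.

Lemma well_order_total R : well_order R -> total R.
Proof.
move=> wo x y; have [[-> _]|->|[-> _]] := strict_or x y wo; rewrite ?orbT //.
by rewrite well_order_refl.
Qed.

Lemma well_order_trans R : well_order R -> transitive R.
Proof.
move=> wo y x z xy yz; have [->//|nxy] := pselect (x = y).
have [<-//|nyz] := pselect (y = z).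
by have [] := strict_trans wo (conj xy nxy) (conj yz nyz).
Qed.

Lemma strict_leF R a b : well_order R -> strict R a b -> ~ R b a.
Proof. by move=> wo [ab nab] /(well_order_anti wo ab). Qed.

Lemma well_orderI R :
    (forall a b, R a b -> R b a -> a = b) ->
    (forall P : W -> Prop, (exists a, P a) -> exists2 a, P a & forall b, P b -> R a b) ->
  well_order R.
Proof.
move=> anti least; apply: antisymmetric_well_order => [a b /andP[]|X [a Xa]].
  exact: anti.
by have [|m Xm minm] := least (fun a => a \in X); [exists a | exists m].
Qed.

Definition lex_le (k : W -> nat) R : rel W :=
  fun a b => (k a < k b)%N || (k a == k b) && R a b.

Lemma lex_le_well_order k R : well_order R -> well_order (lex_le k R).
Proof.
move=> wo; apply: well_orderI => [a b|P [a Pa]].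
  by rewrite /lex_le; case: ltngtP => //= _; apply: well_order_anti.
have exk : exists n, `[<exists2 b, P b & k b = n>].
  by exists (k a); apply/asboolP; exists a.
case: (ex_minnP exk) => n /asboolP[c Pc kc] minn.
have [|m [Pm km] minm] := well_order_least (P := fun b => P b /\ k b = n) wo.
  by exists c.
exists m => // b Pb; have : (n <= k b)%N by apply: minn; apply/asboolP; exists b.
rewrite /lex_le km leq_eqVlt => /predU1P[enk|->//].
by rewrite -enk eqxx minm ?orbT.
Qed.

End WellOrder.

Lemma well_order_sub (V W : Type) (h : V -> W) (R : rel W) :
  injective h -> well_order R -> well_order (relpre h R).
Proof.
move=> inj wo; apply: well_orderI => [a b ab ba|P [a Pa]].
  exact/inj/(well_order_anti wo).
have [|_ [m Pm <-] minm] := well_order_least (P := h @` P) wo.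
  by exists (h a), a.
by exists m => // b Pb; apply: minm; exists b.
Qed.

(** * Right multiplication by a letter in the free group *)

Section Letters.
Variable S : finType.
Local Notation F := (free_group S).
Implicit Types (a : letter S) (u v x y : F).

Definition gen a : F := @FreeGroup S [:: a] isT.

Definition of_word (w : seq (letter S)) : F := FreeGroup (reduce_reduced w).

Lemma of_wordK u : of_word (word u) = u.
Proof. by apply/val_inj; rewrite /= reduce_id ?wordP. Qed.

Lemma gen_inv a : gen (letter_inv a) = (gen a)^-1%g.
Proof. exact/val_inj. Qed.

Lemma gen_mulKV x a : (x * gen (letter_inv a) * gen a)%g = x.
Proof. by rewrite gen_inv mulgVK. Qed.

Lemma gen_mulK x a : (x * gen a * gen (letter_inv a))%g = x.
Proof. by rewrite gen_inv mulgK. Qed.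

Lemma free_group_rconsP x w a :
  word x = rcons w a -> exists2 y : F, word y = w & x = (y * gen a)%g.
Proof.
move=> xw; have rw : reduced w.
  move: (wordP x); rewrite xw /reduced; case: w {xw} => //= b w.
  by rewrite rcons_path => /andP[].
exists (FreeGroup rw) => //; apply/val_inj.
by rewrite /= xw cats1 reduce_id // -xw wordP.
Qed.

(** As [word x] is already reduced, appending [a] can fail only at the last junction, and there the
    two letters cancel. *)
Lemma free_group_mul_gen x a :
  word (x * gen a)%g = rcons (word x) a \/
  word x = rcons (word (x * gen a)%g) (letter_inv a).
Proof.
have [rx|nrx] := boolP (reduced (rcons (word x) a)).
  by left; rewrite /= cats1 reduce_id.
right; case/lastP ex : (word x) => [|w b]; first by rewrite ex in nrx.
have [y yw exy] := free_group_rconsP ex.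
suff eb : b = letter_inv a by rewrite exy eb gen_mulKV yw.
move: nrx (wordP x); rewrite ex /reduced; case: (w) => [|c w'] /=.
  by rewrite andbT negbK => /eqP->; rewrite letter_invK.
rewrite rcons_path last_rcons => /nandP[/negbTE->//|].
by rewrite negbK => /eqP->; rewrite letter_invK.
Qed.

(** The premise that no letter cancels keeps an induction inside a prefix-closed set. *)
Lemma free_group_ind (P : F -> Prop) :
  P 1%g ->
  (forall x a, word (x * gen a)%g = rcons (word x) a -> P x -> P (x * gen a)%g) ->
  forall x, P x.
Proof.
move=> P1 PM x; move: {2}(word x) (erefl (word x)) => w.
elim/last_ind: w x => [|w a IH] x xw; first by have -> : x = 1%g by apply/val_inj.
have [y yw exy] := free_group_rconsP xw; rewrite exy; apply: PM; last exact: IH.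
by rewrite -exy yw.
Qed.

Lemma free_group_mul_ind (P : F -> Prop) :
  P 1%g -> (forall x a, P x -> P (x * gen a)%g) -> forall x, P x.
Proof. by move=> P1 PM; apply: free_group_ind => // x a _; apply: PM. Qed.

Lemma prefix_rconsP u v w a : word v = rcons w a ->
  prefix (word u) (word v) -> u = v \/ prefix (word u) w.
Proof.
move=> vw; rewrite vw => /prefixP[s]; case/lastP: s => [|s b].
  by rewrite cats0 => uw; left; apply/val_inj; rewrite /= vw.
by rewrite -rcons_cat => /rcons_inj[-> _]; right; apply: prefix_prefix.
Qed.

End Letters.

(** * The group algebra, its right ideals and the subspaces [Sp(X) + J] *)

Section Algebra.
Variables (K : fieldType) (G : groupType).
Local Notation A := (group_algebra K G).
Implicit Types (I J : set A) (X Y : set G) (f g h : A) (x y : G).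

Definition ga_word x : A := << x >>.

Lemma ga_wordM x y : ga_word x * ga_word y = ga_word (x * y)%g.
Proof. by rewrite [LHS]ga_mulUU mulr1. Qed.

Lemma ga_word1 : ga_word 1%g = 1.
Proof. by []. Qed.

Lemma ga_scaleU (c d : K) x : c *: (<< d *g x >> : A) = << c * d *g x >>.
Proof. by apply/malgP => y; rewrite mcoeffZ !mcoeffU mulrnAr. Qed.

Lemma ga_monomE (c : K) x : (<< c *g x >> : A) = c *: ga_word x.
Proof. by rewrite ga_scaleU mulr1. Qed.

Lemma ga_scaleAr (c : K) f : f * (c *: 1) = c *: f.
Proof.
elim/ga_ind: f => [|f g IHf IHg|d x]; first by rewrite mul0r scaler0.
  by rewrite mulrDl IHf IHg scalerDr.
rewrite -ga_word1 ga_scaleU mulr1 ga_scaleU.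
by rewrite [LHS]ga_mulUU mulg1 mulrC.
Qed.

Lemma ga_scalerAr (c : K) f g : c *: (f * g) = f * (c *: g).
Proof. by rewrite -ga_scaleAr -mulrA ga_scaleAr. Qed.

Lemma mcoeff_ga_word x y : (ga_word x)@_y = (x == y)%:R.
Proof. by rewrite mcoeffU. Qed.

(* [mcoeffD] and its companions are stated for the additive structure of
   [{malg K[G]}]; these are their versions for that of [A]. *)
Lemma ga_coefD f g x : (f + g)@_x = f@_x + g@_x.
Proof. exact: mcoeffD. Qed.

Lemma ga_coefN f x : (- f)@_x = - f@_x.
Proof. exact: mcoeffN. Qed.

Lemma ga_coefZ c f x : (c *: f)@_x = c * f@_x.
Proof. exact: mcoeffZ. Qed.

Lemma ga_coef0 x : (0 : A)@_x = 0.
Proof. exact: mcoeff0. Qed.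

(* [mulrDl] and [mulrDr] use another instance of [+%R] on [A], which
   makes later unification diverge. *)
Lemma ga_distrl f g h : (f + g) * h = (f * h : A) + (g * h : A).
Proof. exact: mulrDl. Qed.

Lemma ga_distrr f g h : h * (f + g) = (h * f : A) + (h * g : A).
Proof. exact: mulrDr. Qed.

Lemma supported_onP f X :
  supported_on f X <-> forall x, f@_x != 0 -> X x.
Proof. by split=> fX x; have := fX x; rewrite /= mcoeff_neq0. Qed.

Lemma supported_on_coef f X x : supported_on f X -> ~ X x -> f@_x = 0.
Proof. by move=> /supported_onP fX nXx; apply/eqP/negP => /negP/fX. Qed.

Lemma supported_onS f X Y : X `<=` Y -> supported_on f X -> supported_on f Y.
Proof. by move=> XY fX x /fX/XY. Qed.

Lemma supported_on0 X : supported_on (0 : A) X.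
Proof. by apply/supported_onP => x; rewrite ga_coef0 eqxx. Qed.

Lemma supported_onD f g X :
  supported_on f X -> supported_on g X -> supported_on (f + g) X.
Proof.
move=> fX gX; apply/supported_onP => x; move=> /eqP nz; apply: contrapT => nXx; apply: nz.
by rewrite ga_coefD (supported_on_coef fX) ?(supported_on_coef gX) ?addr0.
Qed.

Lemma supported_onZ c f X : supported_on f X -> supported_on (c *: f) X.
Proof.
move=> fX; apply/supported_onP => x; move=> /eqP nz; apply: contrapT => nXx; apply: nz.
by rewrite ga_coefZ (supported_on_coef fX) ?mulr0.
Qed.

Lemma supported_onN f X : supported_on f X -> supported_on (- f) X.
Proof. by rewrite -scaleN1r; apply: supported_onZ. Qed.

Lemma supported_onB f g X :
  supported_on f X -> supported_on g X -> supported_on (f - g) X.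
Proof. by move=> fX /supported_onN; apply: supported_onD. Qed.

Lemma supported_on_word x X : X x -> supported_on (ga_word x) X.
Proof.
move=> Xx; apply/supported_onP => y; rewrite mcoeff_ga_word.
by have [<-|] := eqVneq x y; rewrite ?eqxx.
Qed.

Lemma supported_on_ind X (P : A -> Prop) :
    P 0 -> (forall f g, P f -> P g -> P (f + g)) ->
    (forall c x, X x -> P (c *: ga_word x)) ->
  forall f, supported_on f X -> P f.
Proof.
move=> P0 PD PU f fX; rewrite (monalgE f) big_seq.
by apply: big_ind => // x /fX Xx; rewrite ga_monomE; apply: PU.
Qed.

Lemma ga_word_ind (P : A -> Prop) :
    P 0 -> (forall f g, P f -> P g -> P (f + g)) ->
    (forall c x, P (c *: ga_word x)) ->
  forall f, P f.
Proof. by move=> P0 PD PU; apply: ga_ind => // c x; rewrite ga_monomE. Qed.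

Lemma ga_linear_ext (L1 L2 : A -> K) :
    (forall f g, L1 (f + g) = L1 f + L1 g) -> (forall c f, L1 (c *: f) = c * L1 f) ->
    (forall f g, L2 (f + g) = L2 f + L2 g) -> (forall c f, L2 (c *: f) = c * L2 f) ->
    (forall x, L1 (ga_word x) = L2 (ga_word x)) -> L1 =1 L2.
Proof.
move=> D1 Z1 D2 Z2 eqw; elim/ga_word_ind => [|f g|c x].
- by rewrite -(scale0r 0) Z1 Z2 !mul0r.
- by rewrite D1 D2 => -> ->.
- by rewrite Z1 Z2 eqw.
Qed.

Section RightIdeal.
Variable J : set A.
Hypothesis J_ideal : right_ideal J.

Lemma right_ideal0 : J 0. Proof. by case: J_ideal. Qed.

Lemma right_idealD f g : J f -> J g -> J (f + g).
Proof. by case: J_ideal => _ JD _; apply: JD. Qed.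

Lemma right_idealM f h : J f -> J (f * h).
Proof. by case: J_ideal => _ _; apply. Qed.

Lemma right_idealZ c f : J f -> J (c *: f).
Proof. by rewrite -ga_scaleAr; apply: right_idealM. Qed.

Lemma right_idealN f : J f -> J (- f).
Proof. by rewrite -scaleN1r; apply: right_idealZ. Qed.

Lemma right_idealB f g : J f -> J g -> J (f - g).
Proof. by move=> Jf /right_idealN; apply: right_idealD. Qed.

Lemma right_idealBC f g : J (f - g) -> J (g - f).
Proof. by move=> /right_idealN; rewrite opprB. Qed.

Lemma right_idealBD f g h : J (f - g) -> J (g - h) -> J (f - h).
Proof. by move=> Jfg Jgh; rewrite -(subrKA g); apply: right_idealD. Qed.

End RightIdeal.

Lemma right_ideal_gen (B : set A) : right_ideal (right_ideal_generated B).
Proof.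
split=> [|f g Bf Bg|f h Bf] J [J_ideal BJ]; first exact: right_ideal0.
  by apply: right_idealD => //; [apply: Bf|apply: Bg].
by apply: right_idealM => //; apply: Bf.
Qed.

(** This is the subspace [Sp(X) + J]. *)
Definition span_mod J X : set A := [set f | exists2 g, supported_on g X & J (f - g)].

Section SpanMod.
Variables (J : set A) (X : set G).
Hypothesis J_ideal : right_ideal J.

Lemma span_mod0 : span_mod J X 0.
Proof.
by exists 0; [apply: supported_on0|rewrite subr0; apply: right_ideal0].
Qed.

Lemma span_modD f g : span_mod J X f -> span_mod J X g -> span_mod J X (f + g).
Proof.
move=> [f' f'X Jf] [g' g'X Jg]; exists (f' + g'); first exact: supported_onD.
by rewrite opprD addrACA; apply: right_idealD.
Qed.

Lemma span_modZ c f : span_mod J X f -> span_mod J X (c *: f).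
Proof.
move=> [f' f'X Jf]; exists (c *: f'); first exact: supported_onZ.
by rewrite -scalerBr; apply: right_idealZ.
Qed.

Lemma span_mod_supported f : supported_on f X -> span_mod J X f.
Proof. by exists f => //; rewrite subrr; apply: right_ideal0. Qed.

Lemma span_mod_congr f g : J (f - g) -> span_mod J X g -> span_mod J X f.
Proof. by move=> Jfg [h hX Jgh]; exists h => //; apply: right_idealBD Jgh. Qed.

Lemma span_modM f y : (forall x, X x -> span_mod J X (ga_word (x * y)%g)) ->
  span_mod J X f -> span_mod J X (f * ga_word y).
Proof.
move=> Xy [g gX Jfg]; apply: (@span_mod_congr _ (g * ga_word y)).
  by rewrite -mulrBl; apply: right_idealM.
move: g gX {Jfg}; apply: supported_on_ind => [|g h|c x Xx].
- by rewrite mul0r; apply: span_mod0.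
- by rewrite mulrDl; apply: span_modD.
- by rewrite -ga_scaleAl ga_wordM; apply/span_modZ/Xy.
Qed.

End SpanMod.
End Algebra.

(** * Schreier transversals and the two halves of Lewin's theorem *)

Section FreeAlgebra.
Variables (K : fieldType) (S : finType).
Local Notation F := (free_group S).
Local Notation A := (group_algebra K F).
Implicit Types (I J : set A) (X Y : set F) (f g h : A) (u v w : F) (a : letter S).

Lemma prefix_neighbor1 X : ~ X 1%g -> prefix_neighbor X 1%g.
Proof.
move=> nX1; split=> // u; have -> : word (1%g : F) = [::] by [].
by rewrite prefixs0 => /eqP u1 []; apply/val_inj.
Qed.

(** If a letter cancels, [u a] is a prefix of [u] and stays in [X]; otherwise its proper prefixes
    are prefixes of [u]. *)
Lemma prefix_closed_mul_gen X u a : prefix_closed X -> X u ->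
  X (u * gen a)%g \/
  prefix_neighbor X (u * gen a)%g /\ word (u * gen a)%g = rcons (word u) a.
Proof.
move=> pX Xu; have [Xua|nXua] := pselect (X (u * gen a)%g); [by left|right].
have [eua|eu] := free_group_mul_gen u a; last first.
  by case: nXua; apply: pX Xu; rewrite eu prefix_rcons.
split=> //; split=> // w wua nw.
by have [/nw|] := prefix_rconsP eua wua; last by move/pX; apply.
Qed.

Lemma prefix_neighbor_rcons X u v a :
  prefix_neighbor X v -> word v = rcons (word u) a -> X u.
Proof.
move=> [_ prev] vu; apply: prev; first by rewrite vu prefix_rcons.
move=> uv; move/(congr1 size)/eqP: vu.
by rewrite uv size_rcons (ltn_eqF (ltnSn _)).
Qed.

(** The empty word is in [X] or a neighbor of it, and so is a word of [X] times a letter, unless it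
    is already in [X]. Hence [Sp(X) + J] contains 1 and is stable under multiplication by
    letters. *)
Lemma span_mod_full J X : right_ideal J -> prefix_closed X ->
    (forall v, prefix_neighbor X v -> span_mod J X (ga_word K v)) ->
  forall f, span_mod J X f.
Proof.
move=> JI pX VX.
have inX u : X u -> span_mod J X (ga_word K u).
  by move=> Xu; apply: span_mod_supported => //; apply: supported_on_word.
move=> f; suff V u : span_mod J X (ga_word K u).
  elim/(@ga_word_ind K F): f => [|f g|c x]; [exact: span_mod0|exact: span_modD|by apply: span_modZ].
elim/free_group_mul_ind: u => [|u a IH].
  by have [/inX//|/prefix_neighbor1/VX] := pselect (X 1%g).
rewrite -ga_wordM; apply: (span_modM JI _ IH) => x Xx.
by have [/inX|[/VX]] := prefix_closed_mul_gen a pX Xx.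
Qed.

Section Transversal.
Variables (I : set A) (T : set F).
Hypotheses (I_ideal : right_ideal I) (T_transversal : schreier_transversal I T).

Let T_prefix : prefix_closed T. Proof. by case: T_transversal. Qed.

Lemma transversal_eq f g :
  supported_on f T -> supported_on g T -> I (f - g) -> f = g.
Proof.
case: T_transversal => _ sep _ fT gT Ifg; apply/eqP; rewrite -subr_eq0.
by apply/eqP/sep => //; apply: supported_onB.
Qed.

Local Notation phi := (coset_repr I T).

Lemma coset_reprP f : I (phi f - f) /\ supported_on (phi f) T.
Proof.
rewrite /coset_repr; apply: (@xgetPex _ 0 [set g : A | I (g - f) /\ supported_on g T]).
case: T_transversal => _ _ /(_ f)[g gT Ifg]; exists g; split=> //.
exact: right_idealBC.
Qed.

Lemma coset_repr_supported f : supported_on (phi f) T.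
Proof. by have [] := coset_reprP f. Qed.

Lemma coset_repr_congr f : I (f - phi f).
Proof. by have [? _] := coset_reprP f; apply: right_idealBC. Qed.

Lemma coset_repr_uniq f g : supported_on g T -> I (f - g) -> phi f = g.
Proof.
move=> gT Ifg; apply: transversal_eq => //; first exact: coset_repr_supported.
by apply: right_idealBD Ifg => //; have [] := coset_reprP f.
Qed.

Lemma coset_repr_id f : supported_on f T -> phi f = f.
Proof. by move=> fT; apply: coset_repr_uniq; rewrite // subrr; apply: right_ideal0. Qed.

Lemma coset_repr0 f : I f -> phi f = 0.
Proof. by move=> If; apply: coset_repr_uniq; [exact: supported_on0|rewrite subr0]. Qed.

Lemma coset_reprD f g : phi (f + g) = phi f + phi g.
Proof.
apply: coset_repr_uniq; first by apply: supported_onD; apply: coset_repr_supported.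
by rewrite opprD addrACA; apply: right_idealD => //; apply: coset_repr_congr.
Qed.

Lemma coset_reprZ c f : phi (c *: f) = c *: phi f.
Proof.
apply: coset_repr_uniq; first by apply: supported_onZ; apply: coset_repr_supported.
by rewrite -scalerBr; apply: right_idealZ => //; apply: coset_repr_congr.
Qed.

Definition lewin_elt v : A := ga_word K v - phi (ga_word K v).

Lemma lewin_elt_in v : I (lewin_elt v).
Proof. exact: coset_repr_congr. Qed.

Lemma pos_prefix_neighbor_mul_gen u s : T u -> ~ T (u * gen (s, false))%g ->
  pos_prefix_neighbor T (u * gen (s, false))%g.
Proof.
move=> Tu nT; have [//|[nb wE]] := prefix_closed_mul_gen (s, false) T_prefix Tu.
by split=> //; right; exists (word u), s.
Qed.

Lemma pos_prefix_neighborP v : pos_prefix_neighbor T v ->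
  v = 1%g \/ exists2 u, T u & exists s, v = (u * gen (s, false))%g.
Proof.
case=> nv [v1|[w [s vw]]]; first by left; apply/val_inj.
right; have [u uw vE] := free_group_rconsP vw; exists u; last by exists s.
by apply: prefix_neighbor_rcons nv _; rewrite uw vw.
Qed.

(** By [span_mod_full] it suffices to reduce the neighbors of [T] into [Sp(T)] modulo [J]. The
    generators do this directly on [d_+ T]; a neighbor ending in an inverse letter is multiplied
    back by the letter. *)
Lemma lewin_basis_generates : right_ideal_generated (lewin_basis I T) = I.
Proof.
pose J := right_ideal_generated (lewin_basis I T).
have JI : right_ideal J by apply: right_ideal_gen.
have JsubI : J `<=` I.
  by apply: smallest_sub => // _ [v _ <-]; apply: lewin_elt_in.
have pos v : pos_prefix_neighbor T v -> span_mod J T (ga_word K v).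
  move=> Tv; exists (phi (ga_word K v)); first exact: coset_repr_supported.
  by apply: sub_gen_smallest; exists v.
have posM f s : supported_on f T -> span_mod J T (f * ga_word K (gen (s, false))).
  move=> fT; apply: span_modM => //; last exact: span_mod_supported.
  move=> x Tx; have [Txs|nTxs] := pselect (T (x * gen (s, false))%g).
    by apply: span_mod_supported => //; apply: supported_on_word.
  exact/pos/pos_prefix_neighbor_mul_gen.
(* An element of [I] then agrees modulo [J] with some [g] in [Sp(T)]; this [g] lies in [I], so it
   vanishes. *)
suff full f : span_mod J T f.
  apply/seteqP; split=> // f If; have [g gT Jfg] := full f.
  suff g0 : g = 0 by move: Jfg; rewrite g0 subr0.
  case: T_transversal => _ sep _; apply: sep => //.
  by rewrite -(subKr f g); apply: right_idealB => //; apply: JsubI.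
apply: (span_mod_full JI T_prefix) => v nv.
case/lastP vw : (word v) => [|w [s []]].
- by apply: pos; split=> //; left.
- have [u uw vE] := free_group_rconsP vw.
  have Tu : T u by apply: prefix_neighbor_rcons nv _; rewrite uw vw.
  (* With t = phi(u s^-1), the product t s is congruent to some t' in Sp(T)
     modulo J, and t' = u because t s is congruent to u modulo I. *)
  have vs : (v * gen (s, false) = u)%g by rewrite vE (gen_mulKV u (s, false)).
  pose t := phi (ga_word K v); have tT : supported_on t T by apply: coset_repr_supported.
  have [t' t'T Jtt'] := posM t s tT.
  have t'u : t' = ga_word K u.
    apply: transversal_eq => //; first exact: supported_on_word.
    rewrite -vs -ga_wordM; apply: (right_idealBD I_ideal (g := t * ga_word K (gen (s, false)))).
      by apply: right_idealBC => //; apply: JsubI.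
    rewrite -mulrBl; apply: right_idealM => //.
    by apply: right_idealBC => //; apply: coset_repr_congr.
  have ss : (gen (s, false) * gen (s, true) = 1)%g by apply/val_inj; rewrite /= eqxx.
  exists t => //; apply: (right_idealBC JI).
  have -> : t - ga_word K v = (t * ga_word K (gen (s, false)) - t') * ga_word K (gen (s, true)).
    by rewrite mulrBl -mulrA ga_wordM ss mulr1 t'u ga_wordM -vE.
  by apply: (right_idealM JI).
- by apply: pos; split=> //; right; exists w, s.
Qed.


(* The right module [A / I (+) K], on which a letter s acts by
   (t, c) |-> (t s, c + (coefficient of v in t s)) for t in Sp(T). The second
   coordinate of the image of (1, [v = 1]) under u is [fox u], a Fox derivative;
   it vanishes on T and separates v from the other elements of d_+ T. *)
Section Fox.
Variable v : F.
Hypothesis v_pos : pos_prefix_neighbor T v.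

(** Increment of the second coordinate when [u] is multiplied by [a]. An inverse letter must undo
    the action of its letter, hence the sign and the use of [phi] after the step. *)
Definition fox_step u a : K :=
  if a.2 then - (phi (ga_word K (u * gen a)%g) * ga_word K (gen (letter_inv a)))@_v
  else (phi (ga_word K u) * ga_word K (gen a))@_v.

Lemma fox_step_inv u a : fox_step (u * gen a)%g (letter_inv a) = - fox_step u a.
Proof.
by case: a => s [] /=; rewrite /fox_step /= ?gen_mulK ?opprK // (gen_mulK u (s, false)).
Qed.

(** The word is given in reverse so that structural recursion removes its last letter. *)
Fixpoint fox_rev (r : seq (letter S)) : K :=
  if r is a :: r' then fox_rev r' + fox_step (of_word (rev r')) a
  else (v == 1%g)%:R.

Definition fox u : K := fox_rev (rev (word u)).

Lemma fox_rcons u w a : word w = rcons (word u) a -> fox w = fox u + fox_step u a.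
Proof.
by move=> wu; rewrite /fox wu rev_rcons /= revK of_wordK.
Qed.

(** The rule survives cancellation because a step along a letter and the step back sum to zero. *)
Lemma fox_mul_gen u a : fox (u * gen a)%g = fox u + fox_step u a.
Proof.
have [/fox_rcons//|/fox_rcons->] := free_group_mul_gen u a.
by rewrite fox_step_inv subrK.
Qed.

Definition fox_der f : K := mmap idfun fox f.

Lemma fox_derD f g : fox_der (f + g) = fox_der f + fox_der g.
Proof. exact: mmapD. Qed.

Lemma fox_der0 : fox_der 0 = 0.
Proof. exact: mmap0. Qed.

Lemma fox_derN f : fox_der (- f) = - fox_der f.
Proof. exact: mmapN. Qed.

Lemma fox_der_monom c u : fox_der (c *: ga_word K u) = c * fox u.
Proof. by rewrite -ga_monomE; apply: mmapU. Qed.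

Lemma fox_der_word u : fox_der (ga_word K u) = fox u.
Proof. by rewrite -[ga_word K u]scale1r fox_der_monom mul1r. Qed.

Lemma fox_derZ c f : fox_der (c *: f) = c * fox_der f.
Proof.
rewrite [LHS](mmapEw (msuppZ_le c f)) mulr_sumr.
by apply: eq_bigr => x _; rewrite ga_coefZ mulrA.
Qed.

Lemma fox_der_mul_gen f s :
  fox_der (f * ga_word K (gen (s, false))) =
  fox_der f + (phi f * ga_word K (gen (s, false)))@_v.
Proof.
set p := ga_word K _; move: f; apply: ga_linear_ext => [f g|c f|f g|c f|x].
- by rewrite ga_distrl fox_derD.
- by rewrite -ga_scaleAl fox_derZ.
- by rewrite fox_derD coset_reprD ga_distrl ga_coefD addrACA.
- by rewrite fox_derZ coset_reprZ -ga_scaleAl ga_coefZ mulrDr.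
- by rewrite ga_wordM !fox_der_word fox_mul_gen.
Qed.

(** The correction term of [fox_der_mul_gen] vanishes on [I], since [phi] does. For an inverse
    letter, this is applied to [f s^-1], which is again in [I]. *)
Lemma fox_der_ideal_gen f a : I f -> fox_der (f * ga_word K (gen a)) = fox_der f.
Proof.
have pos g s : I g -> fox_der (g * ga_word K (gen (s, false))) = fox_der g.
  by move=> Ig; rewrite fox_der_mul_gen coset_repr0 // mul0r ga_coef0 addr0.
case: a => s [] If; last exact: pos.
have Ig : I (f * ga_word K (gen (s, true))) by apply: right_idealM.
rewrite -(pos _ s Ig) -mulrA ga_wordM.
by rewrite [X in ga_word K X](mulVg (gen (s, false))) mulr1.
Qed.

(** Stability under right multiplication comes from the invariance on [I], applied letter by letter;
    this is why the kernel is intersected with [I]. *)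
Lemma fox_der_ker_ideal : right_ideal (I `&` [set f | fox_der f = 0]).
Proof.
split=> [|f g [If f0] [Ig g0]|f h [If f0]].
- by split; [exact: right_ideal0|exact: fox_der0].
- by split; [exact: right_idealD|rewrite /= fox_derD f0 g0 addr0].
split; first exact: right_idealM.
move: h; apply: (@ga_linear_ext K F (fun h => fox_der (f * h)) (fun=> 0)) => [g h|c h|g h|c h|x].
- by rewrite ga_distrr fox_derD.
- by rewrite -ga_scalerAr fox_derZ.
- by rewrite addr0.
- by rewrite mulr0.
elim/free_group_mul_ind: x => [|x a IH]; first by rewrite mulr1.
by rewrite -ga_wordM mulrA fox_der_ideal_gen //; apply: right_idealM.
Qed.

(** Induction along prefixes never leaves [T], where [phi] is the identity. So each step reads, up
    to sign, the coefficient of [v] in a word of [T], and [v] is not in [T]. *)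
Lemma fox_transversal u : T u -> fox u = 0.
Proof.
have nTv : ~ T v by case: v_pos => -[].
have eqv x : T x -> (x == v) = false by move=> Tx; apply/eqP => xv; case: nTv; rewrite -xv.
elim/free_group_ind: u => [T1|u a uaE IH Tua].
  by rewrite /fox /= eq_sym eqv.
have Tu : T u by apply: T_prefix Tua; rewrite uaE prefix_rcons.
rewrite fox_mul_gen IH // add0r /fox_step !coset_repr_id; try exact: supported_on_word.
by rewrite !ga_wordM gen_mulK !mcoeff_ga_word !eqv // oppr0; case: ifP.
Qed.

(** Write [w = u s] with [u] in [T]: [fox] vanishes at [u], and the last step, along a positive
    letter, reads the coefficient of [v] in [w] itself. For [w = 1] only the initial value
    remains. *)
Lemma fox_pos_neighbor w : pos_prefix_neighbor T w -> fox w = (w == v)%:R.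
Proof.
have nTv : ~ T v by case: v_pos => -[].
move=> w_pos; have [->|[u Tu [s ->]]] := pos_prefix_neighborP w_pos.
  by rewrite eq_sym.
rewrite fox_mul_gen fox_transversal // add0r /fox_step /= coset_repr_id.
  by rewrite ga_wordM mcoeff_ga_word.
exact: supported_on_word.
Qed.

Lemma fox_der_supported X f : (forall u, X u -> fox u = 0) ->
  supported_on f X -> fox_der f = 0.
Proof.
move=> X0; move: f; apply: supported_on_ind => [|f g f0 g0|c x Xx].
- exact: fox_der0.
- by rewrite fox_derD f0 g0 addr0.
- by rewrite fox_der_monom X0 ?mulr0.
Qed.

Lemma fox_der_lewin_elt w : pos_prefix_neighbor T w ->
  fox_der (lewin_elt w) = (w == v)%:R.
Proof.
move=> w_pos; rewrite fox_derD fox_derN fox_der_word fox_pos_neighbor //.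
rewrite (fox_der_supported fox_transversal) ?subr0 //.
exact: coset_repr_supported.
Qed.

(** Independence in the form used below: the generators lie in the right ideal of
    [fox_der_ker_ideal], hence so does all that they generate. *)
Lemma fox_der_lewin_ideal X f : X `<=` pos_prefix_neighbor T -> ~ X v ->
  right_ideal_generated (lewin_elt @` X) f -> fox_der f = 0.
Proof.
move=> Xpos nXv Xf; have [|_ //] := Xf (I `&` [set f | fox_der f = 0]).
split; first exact: fox_der_ker_ideal.
move=> _ [w Xw <-]; split; first exact: lewin_elt_in.
rewrite /= fox_der_lewin_elt; last exact: Xpos.
by case: eqP => // wv; rewrite wv in Xw.
Qed.

End Fox.
End Transversal.
End FreeAlgebra.

Lemma max_exists (W : eqType) (le : rel W) (s : seq W) : total le -> transitive le ->
  s != [::] -> exists2 u, u \in s & forall v, v \in s -> le v u.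
Proof.
move=> tot tr; elim: s => // a s IH _; have [->|s0] := eqVneq s [::].
  by exists a; rewrite ?mem_head // => v /[!inE] /eqP->; rewrite -[le a a]orbb tot.
have [u us maxu] := IH s0; case/orP: (tot a u) => [au|ua].
  by exists u; rewrite ?inE ?us ?orbT // => v /[!inE] /predU1P[->|/maxu].
exists a; rewrite ?mem_head // => v /[!inE] /predU1P[->|/maxu vu].
  by rewrite -[le a a]orbb tot.
exact: tr vu ua.
Qed.

(** * The minimal transversal as the outcome of a greedy choice *)

Section Greedy.
Variables (K : fieldType) (S : finType).
Local Notation F := (free_group S).
Local Notation A := (group_algebra K F).
Variable le : rel F.
Hypothesis le_exposure : exposure_order le.
Implicit Types (J : set A) (X Y : set F) (f g h : A) (p u v w : F).

Let le_wo : well_order le. Proof. by case: le_exposure. Qed.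

Lemma prefix_strict u v : prefix (word u) (word v) -> u <> v -> strict le u v.
Proof. by move=> uv nuv; split=> //; case: le_exposure => _; apply. Qed.

Lemma head_term_exists f : f <> 0 -> exists u, head_term le f u.
Proof.
move=> /eqP f0.
have [|u uf maxu] :=
    max_exists (well_order_total le_wo) (well_order_trans le_wo) (s := msupp f).
  apply: contra f0 => /eqP f0; apply/eqP/malgP => x; rewrite mcoeff0.
  by apply: mcoeff_outdom; rewrite -[_ \in _]/(_ \in (msupp f : seq _)) f0.
by exists u.
Qed.

Lemma head_term_coef f u : head_term le f u -> f@_u != 0.
Proof. by case=> uf _; rewrite mcoeff_neq0. Qed.

Lemma head_term_le f u v : head_term le f u -> f@_v != 0 -> le v u.
Proof. by case=> _ maxu; rewrite mcoeff_neq0; apply: maxu. Qed.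

Definition below u : set F := [set w | strict le w u].

(* The transversal obtained by keeping, along the order, every word that has
   all its proper prefixes kept and is not congruent modulo J to a combination
   of smaller kept words. *)
Definition greedy J X : Prop :=
  forall u, X u <-> (forall p, prefix (word p) (word u) -> p <> u -> X p) /\
                    ~ span_mod J (X `&` below u) (ga_word K u).

Lemma strict_wf : well_founded (strict le).
Proof. by apply: (strict_ind le_wo) => u IH; apply: Acc_intro. Qed.

(** Proper prefixes come earlier in an exposure order, so membership of [u] depends on earlier words
    only and well-founded recursion applies. *)
Lemma greedy_exists J : exists X, greedy J X.
Proof.
pose step u (kept : forall w, strict le w u -> Prop) : Prop :=
  (forall p, prefix (word p) (word u) -> forall pu : strict le p u, kept p pu) /\
  ~ span_mod J [set w | exists wu : strict le w u, kept w wu] (ga_word K u).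
pose X := Fix strict_wf (fun=> Prop) step.
have XE u : X u = step u (fun w _ => X w).
  apply: (Fix_eq strict_wf (fun=> Prop) step) => {u} u k k' kk'.
  suff -> : k = k' by [].
  by apply/functional_extensionality_dep => w; apply/functional_extensionality_dep => wu.
exists X => u; have EB : X `&` below u = [set w | exists _ : strict le w u, X w].
  by apply/seteqP; split=> [w [Xw wu]|w [wu Xw]]; [exists wu|split].
rewrite EB XE; split=> -[Xp nspan]; split=> // p pu npu.
  exact/Xp/prefix_strict.
by apply: Xp => //; case: npu.
Qed.

Section GreedyTransversal.
Variables (J : set A) (X : set F).
Hypotheses (J_ideal : right_ideal J) (X_greedy : greedy J X).

Lemma greedy_prefix_closed : prefix_closed X.
Proof.
move=> u v uv Xv; have [->//|nuv] := pselect (u = v).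
by have [Xp _] := (X_greedy v).1 Xv; apply: Xp.
Qed.

(** A nonzero element of [J] supported on [X], divided by its leading coefficient, would write its
    head term through earlier kept words modulo [J]. A neighbor of [X] has its proper prefixes kept,
    so it was rejected for lying in [Sp(X) + J]. *)
Lemma greedy_schreier : schreier_transversal J X.
Proof.
split; first exact: greedy_prefix_closed.
  move=> f fX Jf; apply: contrapT => /head_term_exists[u hu].
  have fu : f@_u != 0 := head_term_coef hu.
  have Xu : X u by move/supported_onP: fX => /(_ _ fu).
  have [_] := (X_greedy u).1 Xu; apply.
  exists (ga_word K u - (f@_u)^-1 *: f).
    apply/supported_onP => x; rewrite ga_coefD ga_coefN ga_coefZ mcoeff_ga_word.
    have [<-|nux] := eqVneq u x; first by rewrite mulVf // subrr eqxx.
    rewrite sub0r oppr_eq0 mulf_eq0 negb_or => /andP[_ fx]; split.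
      by move/supported_onP: fX => /(_ _ fx).
    by split; [exact: head_term_le fx|move=> xu; rewrite xu eqxx in nux].
  by rewrite subKr; apply: right_idealZ.
move=> f; apply: (span_mod_full J_ideal greedy_prefix_closed) => v [nXv prev].
apply: contrapT => nspan; apply: nXv; apply/X_greedy; split=> // -[g gX Jg].
by apply: nspan; exists g => //; apply: supported_onS gX => x [].
Qed.

(** Suppose the first difference [m] is in [Y]. Both sets agree before [m], so its proper prefixes
    are in [X], and a relation rejecting [m] from [X] would be a nonzero element of [J] supported on
    [Y]. *)
Lemma greedy_min Y : schreier_transversal J Y -> Y <> X -> lt_min le X Y.
Proof.
move=> Y_tr nYX.
have [|m Dm minm] := well_order_least (P := symdiff X Y) le_wo.
  apply: contrapT => noD; apply: nYX; apply/seteqP; split=> x Hx.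
    by apply: contrapT => nx; apply: noD; exists x; right.
  by apply: contrapT => nx; apply: noD; exists x; left.
exists m; split=> //; apply: contrapT => nXm.
have Ym : Y m by case: Dm => -[].
have belowE x : strict le x m -> (X x <-> Y x).
  move=> xm; have nD : ~ symdiff X Y x by move=> /minm; apply: (strict_leF le_wo).
  by split=> Hx; apply: contrapT => nx; apply: nD; [left|right].
have [pY sepY _] := Y_tr.
apply: nXm; apply/X_greedy; split=> [p pm npm|[g gX Jg]].
  by apply/belowE; [exact: prefix_strict|exact: pY Ym].
have gm : g@_m = 0 by apply: (supported_on_coef gX) => -[_ []].
have : ga_word K m - g = 0.
  apply: sepY Jg; apply: supported_onB; first exact: supported_on_word.
  by apply: supported_onS gX => x [Xx xm]; apply/(belowE x xm).
move/(congr1 (mcoeff m))/eqP.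
by rewrite ga_coefD ga_coefN gm mcoeff_ga_word eqxx subr0 ga_coef0 oner_eq0.
Qed.

End GreedyTransversal.

(** This trades the choice of a [lt_min]-minimum for a criterion tested word by word. *)
Lemma min_transversal_greedy J : right_ideal J -> greedy J (min_transversal le J).
Proof.
move=> J_ideal; have [X X_greedy] := greedy_exists J.
suff -> : min_transversal le J = X by [].
have X_tr := greedy_schreier J_ideal X_greedy.
have X_min := greedy_min X_greedy.
rewrite /min_transversal; case: xgetP => [Y _ [Y_tr Y_min]|]; last first.
  by move=> /(_ X) []; split.
apply: contrapT => nYX.
(* Two distinct minima would precede each other; both comparisons are decided at the same first
   difference, which would lie in both sets. *)
have [m [Xm [Dm minm]]] := X_min Y Y_tr nYX.
have [m' [Ym' [Dm' minm']]] : lt_min le Y X by apply: Y_min => // /esym.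
have Dsym x : symdiff X Y x -> symdiff Y X x by rewrite /symdiff setUC.
have Dsym' x : symdiff Y X x -> symdiff X Y x by rewrite /symdiff setUC.
have mm' : m = m' by apply: (well_order_anti le_wo); [apply/minm/Dsym'|apply/minm'/Dsym].
by move: Ym' Dm; rewrite -mm' => Ym [] [].
Qed.

End Greedy.

(** The order compares layers, then lengths, and breaks ties by an arbitrary well-order [le0].
    Prefixes come first: proper prefixes of words of [X] or [d_+ X] are in [X], so the layer never
    drops along prefixes, while the length grows. *)
Lemma lewin_order_exists (S : finType) (X : set (free_group S)) : prefix_closed X ->
  exists le : rel (free_group S), [/\ exposure_order le,
    forall u v, X u -> ~ X v -> strict le u v
  & forall u v, pos_prefix_neighbor X v -> strict le u v ->
      X u \/ pos_prefix_neighbor X u].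
Proof.
move=> pX; have [le0 wo0] := well_ordering_principle (free_group S).
pose rank u : nat :=
  if `[<X u>] then 0%N else if `[<pos_prefix_neighbor X u>] then 1%N else 2%N.
pose le := lex_le rank (lex_le (fun u => size (word u)) le0).
have rankX u : X u -> rank u = 0%N by rewrite /rank; case: asboolP.
have rankN u : ~ X u -> (0 < rank u)%N.
  by rewrite /rank; case: asboolP => // _ _; case: ifP.
have rankP u : pos_prefix_neighbor X u -> rank u = 1%N.
  by move=> Pu; rewrite /rank; case: asboolP => [|_]; [case: Pu => -[]|case: asboolP].
exists le; split.
- split; first exact/lex_le_well_order/lex_le_well_order.
  move=> u v uv; have [->|nuv] := pselect (u = v).
    by apply: well_order_refl; exact/lex_le_well_order/lex_le_well_order.
  have szuv : (size (word u) < size (word v))%N.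
    rewrite ltn_neqAle size_prefix // andbT; apply/eqP => eqsz; apply: nuv; apply/val_inj.
    move/prefixP: uv eqsz => [s /= ->]; rewrite size_cat -{1}[size _]addn0.
    by move=> /addnI; case: s; rewrite //= cats0.
  have : (rank u <= rank v)%N.
    have [/rankX->//|nXu] := pselect (X u).
    have nXv : ~ X v by move/(pX _ _ uv).
    have nPv : ~ pos_prefix_neighbor X v by case=> -[_ /(_ u uv nuv)].
    rewrite {2}/rank; case: asboolP => // _; case: asboolP => // _.
    by rewrite /rank; case: asboolP => // _; case: ifP.
  by rewrite /le /lex_le szuv leq_eqVlt => /orP[->|->]; rewrite ?orbT.
- move=> u v Xu nXv; split; last by move=> uv; rewrite uv in Xu.
  by rewrite /le /lex_le rankX // rankN.
- move=> u v Pv [uv _]; apply: contrapT => /not_orP[nXu nPu].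
  have rku : rank u = 2%N by rewrite /rank; case: asboolP => // _; case: asboolP.
  by move: uv; rewrite /le /lex_le rku (rankP _ Pv).
Qed.

(** * The exposure process for an order adapted to [T] *)

Section LewinOrder.
Variables (K : fieldType) (S : finType).
Local Notation F := (free_group S).
Local Notation A := (group_algebra K F).
Variables (I : set A) (T : set F).
Hypotheses (I_ideal : right_ideal I) (T_transversal : schreier_transversal I T).
Implicit Types (J : set A) (X Y : set F) (f g h : A) (u v w x : F).

Local Notation pos := (pos_prefix_neighbor T).
Local Notation phi := (coset_repr I T).

Variable le : rel F.
Hypothesis le_exposure : exposure_order le.
Hypothesis T_lt : forall u v, T u -> ~ T v -> strict le u v.
Hypothesis lt_pos : forall u v, pos v -> strict le u v -> T u \/ pos u.

Let le_wo : well_order le. Proof. by case: le_exposure. Qed.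
Let T_prefix : prefix_closed T. Proof. by case: T_transversal. Qed.

Lemma below_transversal u x : T u -> strict le x u -> T x.
Proof. by move=> Tu [xu _]; apply: contrapT => /(T_lt Tu)/(strict_leF le_wo). Qed.

Section Step.
Variable v : F.
Hypothesis v_pos : pos v.

Let nTv : ~ T v. Proof. by case: v_pos => -[]. Qed.

Local Notation J := (right_ideal_generated (lewin_elt I T @` (pos `&` below le v))).
Local Notation Y := (min_transversal le J).

Let J_ideal : right_ideal J. Proof. exact: right_ideal_gen. Qed.
Let Y_greedy : greedy le J Y. Proof. exact: min_transversal_greedy. Qed.

Lemma lewin_ideal_sub : J `<=` I.
Proof. by apply: smallest_sub => // _ [w _ <-]; apply: lewin_elt_in. Qed.

(** The Fox derivative at [v] kills [J] but is 1 at [b_v]. Hence [J] differs from [I] and the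
    process goes on. *)
Lemma lewin_elt_notin : ~ J (lewin_elt I T v).
Proof.
move/(fox_der_lewin_ideal I_ideal T_transversal v_pos (@subIsetl _ _ _)).
rewrite fox_der_lewin_elt // eqxx => one0.
have /eqP : 1%:R = 0 :> K by apply: one0 => -[_ []].
by rewrite oner_eq0.
Qed.

(** Only words of [T] precede a word of [T], so a rejection would give a nontrivial relation among
    words of [T] modulo [J], hence modulo [I]. *)
Lemma min_transversal_sub : T `<=` Y.
Proof.
move=> u; move: u; apply: (strict_ind le_wo) => u IH Tu; apply/Y_greedy; split=> [p pu npu|].
  by apply: IH; [exact: prefix_strict|exact: T_prefix Tu].
move=> [g gY Jg].
have gu : g@_u = 0 by apply: (supported_on_coef gY) => -[_ []].
have gE : ga_word K u = g.
  apply: (transversal_eq T_transversal); first exact: supported_on_word.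
    by apply: supported_onS gY => x [_ /(below_transversal Tu)].
  exact: lewin_ideal_sub.
by move/eqP: gu; rewrite -gE mcoeff_ga_word eqxx oner_eq0.
Qed.

(** Were [w] rejected, it would reduce modulo [J] to earlier words, all in [T] or in [d_+ T]. The
    Fox derivative at [w] vanishes on these and on [J], yet is 1 at [w]. *)
Lemma min_transversal_ge w : pos w -> ~ strict le w v -> Y w.
Proof.
move=> w_pos nwv; apply/Y_greedy; split=> [p pw npw|[g gY Jg]].
  by apply: min_transversal_sub; case: w_pos => -[_ +] _; apply.
have := fox_der_lewin_ideal I_ideal T_transversal w_pos (@subIsetl _ _ _) _ Jg.
move=> /(_ (fun wX => nwv wX.2)); rewrite fox_derD fox_derN fox_der_word.
rewrite (fox_pos_neighbor I_ideal T_transversal w_pos w_pos) eqxx.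
rewrite (fox_der_supported _ gY) ?subr0 => [/eqP|x [_ xw]]; first by rewrite oner_eq0.
have [Tx|x_pos] := lt_pos w_pos xw; first exact: (fox_transversal I_ideal T_transversal).
rewrite (fox_pos_neighbor I_ideal T_transversal w_pos x_pos); case: eqP => // xw'.
by case: xw.
Qed.

(** The generator [b_w] of [J] rewrites [w] as [phi(w)], whose words lie in [T], so they are kept
    and precede [w]. *)
Lemma min_transversal_lt w : pos w -> strict le w v -> ~ Y w.
Proof.
move=> w_pos wv Yw; have [_] := (Y_greedy w).1 Yw; apply.
exists (phi (ga_word K w)); last by apply: sub_gen_smallest; exists w.
apply: supported_onS (coset_repr_supported I_ideal T_transversal (f := ga_word K w)) => x Tx.
split; first exact: min_transversal_sub.
by apply: T_lt => //; case: w_pos => -[].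
Qed.

Lemma min_transversal_below x : Y x -> strict le x v -> T x.
Proof. by move=> Yx xv; have [//|/min_transversal_lt] := lt_pos v_pos xv; case. Qed.

Lemma lewin_elt_coef : (lewin_elt I T v)@_v = 1.
Proof.
rewrite ga_coefD ga_coefN mcoeff_ga_word eqxx.
by rewrite (supported_on_coef (coset_repr_supported I_ideal T_transversal (f := _)) nTv) subr0.
Qed.

Lemma lewin_elt_supported x : (lewin_elt I T v)@_x != 0 -> T x \/ x = v.
Proof.
move=> bx; apply: contrapT => /not_orP[nTx nxv]; move/eqP: bx; apply.
rewrite ga_coefD ga_coefN mcoeff_ga_word.
rewrite (supported_on_coef (coset_repr_supported I_ideal T_transversal (f := _)) nTx) subr0.
by case: eqP => // vx; case: nxv.
Qed.

Lemma lewin_elt_head : head_term le (lewin_elt I T v) v.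
Proof.
split; first by rewrite -mcoeff_neq0 lewin_elt_coef oner_eq0.
move=> x; rewrite -mcoeff_neq0 => /lewin_elt_supported[Tx|->].
  by have [] := T_lt Tx nTv.
exact: (well_order_refl le_wo).
Qed.

Local Notation candidate := (exposure_candidate le I J).

Lemma lewin_elt_candidate : candidate (lewin_elt I T v).
Proof.
split; first exact: lewin_elt_in.
  by exists v; [exact: lewin_elt_head|exact: lewin_elt_coef].
apply/supported_onP => x /lewin_elt_supported[/min_transversal_sub//|->].
by apply: min_transversal_ge => // -[].
Qed.

(** With an earlier head term, all words of [g] would be kept words before [v], hence in [T],
    forcing [g = 0]. *)
Lemma candidate_head_ge g u : candidate g -> head_term le g u -> le v u.
Proof.
move=> [Ig _ /supported_onP gY] hu.
have [[] //|->|uv] := strict_or v u le_wo; first exact: (well_order_refl le_wo).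
have gT : supported_on g T.
  apply/supported_onP => x gx; apply: min_transversal_below (gY x gx) _.
  have [xu|xu] := pselect (x = u); first by rewrite xu.
  by apply: (strict_trans le_wo) uv; split=> //; apply: head_term_le hu gx.
have g0 : g = 0 by case: T_transversal => _ sep _; apply: sep.
by move: (head_term_coef hu); rewrite g0 ga_coef0 eqxx.
Qed.

(** Cancelling head terms leaves [v - g] supported on [T] and congruent to [v] modulo [I], so it is
    [phi(v)]. *)
Lemma candidate_head_eq g : candidate g -> head_term le g v -> g = lewin_elt I T v.
Proof.
move=> [Ig [u hu gu] /supported_onP gY] hv.
have uv : u = v.
  by apply: (well_order_anti le_wo);
    [apply: head_term_le hv _; rewrite gu oner_neq0|apply: head_term_le hu (head_term_coef hv)].
rewrite {}uv in gu {hu}.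
suff E : ga_word K v - g = phi (ga_word K v) by rewrite /lewin_elt -E subKr.
apply: (transversal_eq T_transversal); last 1 first.
- rewrite addrAC; apply: right_idealB => //; exact: lewin_elt_in.
- apply/supported_onP => x; rewrite ga_coefD ga_coefN mcoeff_ga_word.
  have [<-|nvx] := eqVneq v x; first by rewrite gu subrr eqxx.
  rewrite sub0r oppr_eq0 => gx; apply: min_transversal_below (gY x gx) _.
  by split; [exact: head_term_le hv gx|move=> xv; rewrite xv eqxx in nvx].
- exact: coset_repr_supported.
Qed.

(** Any candidate other than [b_v] has a head term after [v]. That word is the maximum of the
    symmetric difference of the supports and lies on the side of the candidate. *)
Lemma lewin_elt_minimal :
  unique (support_minimal le candidate) (lewin_elt I T v).
Proof.
split=> [|g [cg ming]].
  split=> [|g cg nsupp]; first exact: lewin_elt_candidate.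
  have [_ [u hu _] _] := cg; have vu := candidate_head_ge cg hu.
  have nuv : u <> v.
    by move=> uv; apply: nsupp; rewrite uv in hu; rewrite (candidate_head_eq cg hu).
  have [ug maxu] := hu; have [_ maxv] := lewin_elt_head.
  exists u; split=> //; split=> [|x [[+ _]|[+ _]]].
  - by right; split=> // /maxv uv; apply: nuv; apply: (well_order_anti le_wo).
  - by move=> /maxv xv; apply: (well_order_trans le_wo) vu.
  - exact: maxu.
have [_ [u hu _] _] := cg; have vu := candidate_head_ge cg hu.
have [uv|nuv] := pselect (u = v).
  by rewrite uv in hu; rewrite (candidate_head_eq cg hu).
have [ug _] := hu; have [_ maxv] := lewin_elt_head.
have nub : ~ (u \in msupp (lewin_elt I T v)).
  by move=> /maxv uv; apply: nuv; apply: (well_order_anti le_wo).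
(* If [g] were also minimal with [u] after [v], the deciding word [m] would be in the support of
   [b_v], whence [u <= m <= v]. *)
have [|m [mb [_ minm]]] := ming _ lewin_elt_candidate.
  by move=> eqs; apply: nub; rewrite eqs.
case: nuv; apply: (well_order_anti le_wo) => //.
by apply: (well_order_trans le_wo) (maxv _ mb); apply: minm; left.
Qed.

End Step.

(** The set [d_+ T] with the restricted order serves as the ordinal, so the ideal at stage [v] is
    the [J_v] studied above. *)
Lemma lewin_exposure_basis : is_exposure_basis le I (lewin_basis I T).
Proof.
pose W := {v : F | pos v}; pose b (a : W) : A := lewin_elt I T (sval a).
pose leW : rel W := relpre (@sval _ _) le.
have inj : injective (@sval F pos).
  by move=> [x px] [y py] /= xy; case: _ / xy py => py; congr exist; apply: Prop_irrelevance.
have range_b : lewin_basis I T = range b.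
  apply/seteqP; split=> [_ [v v_pos <-]|_ [[v v_pos] _ <-]]; last by exists v.
  by exists (exist _ v v_pos).
have segE a : b @` [set c | strict leW c a] = lewin_elt I T @` (pos `&` below le (sval a)).
  apply/seteqP; split.
    move=> _ [c [ca nca] <-]; exists (sval c); last by [].
    by split; [exact: (svalP c)|split=> // /inj].
  move=> _ [w [w_pos [wa nwa]] <-]; exists (exist _ w w_pos); last by [].
  by split=> // eqwa; apply: nwa; rewrite -eqwa.
have idealE a : exposure_ideal leW b a =
    right_ideal_generated (lewin_elt I T @` (pos `&` below le (sval a))).
  by rewrite /exposure_ideal segE.
exists W, leW, b; split=> //; split.
- exact: well_order_sub.
- move=> a; rewrite idealE => eqI; apply: (lewin_elt_notin (svalP a)).
  by rewrite eqI; apply: lewin_elt_in.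
- by move=> a; rewrite idealE; apply: lewin_elt_minimal (svalP a).
- by rewrite -range_b; apply: lewin_basis_generates.
Qed.

End LewinOrder.

Theorem proposition3p47 (K : fieldType) (S : finType)
    (I : set (group_algebra K (free_group S))) (T : set (free_group S))
    (I_ideal : right_ideal I) (T_transversal : schreier_transversal I T) :
  exists le : rel (free_group S),
    exposure_order le /\ is_exposure_basis le I (lewin_basis I T).
Proof.
have [T_prefix _ _] := T_transversal.
have [le [le_exposure T_lt lt_pos]] := lewin_order_exists T_prefix.
by exists le; split=> //; apply: lewin_exposure_basis.
Qed.
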